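(* Let $(\varphi,\vec\xi,\eta,g)$ be an almost contact metric structure on a smooth manifold $X$ of odd dimension $n$, let $D=\ker\eta$, let $\omega=d\eta$, and assume that $\omega|_D$ is non-degenerate and $\ker\omega=\mathrm{span}(\vec\xi)$. Let $P:TX\to D$ be the projection along $\mathrm{span}(\vec\xi)$ and let $N_\varphi$ be the Nijenhuis torsion of $\varphi$. Then the structure is normal, i.e. $N_\varphi+2d\eta\otimes\vec\xi=0$, if and only if both of the following conditions hold: $$P(N_\varphi)=0,\qquad \omega(\varphi\vec u,\varphi\vec v)=\omega(\vec u,\vec v)\ \text{ for all sections } \vec u,\vec v \text{ of } D.$$
   Context: All objects are $C^\infty$. An almost contact metric structure on $X$ is a tuple $(\varphi,\vec\xi,\eta,g)$, where $\varphi$ is a $(1,1)$-tensor field, $\vec\xi$ a vector field, $\eta$ a 1-form and $g$ a (pseudo-)Riemannian metric on $X$, such that $\eta(\vec\xi)=1$, $\varphi(\vec\xi)=0$, $\eta\circ\varphi=0$, $\varphi^2\vec X=-\vec X+\eta(\vec X)\vec\xi$ and $g(\varphi\vec X,\varphi\vec Y)=g(\vec X,\vec Y)-\eta(\vec X)\eta(\vec Y)$ for all vector fields $\vec X,\vec Y$. The Nijenhuis torsion is $N_\varphi(\vec X,\vec Y)=[\varphi\vec X,\varphi\vec Y]+\varphi^2[\vec X,\vec Y]-\varphi[\varphi\vec X,\vec Y]-\varphi[\vec X,\varphi\vec Y]$, and $P(N_\varphi)=0$ means $P(N_\varphi(\vec X,\vec Y))=0$ for all vector fields $\vec X,\vec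 Y$ on $X$. Write $D^\perp=\mathrm{span}(\vec\xi)$, so $TX=D\oplus D^\perp$. Convention for the exterior derivative of a 1-form: $d\eta(\vec X,\vec Y)=\tfrac12\big(\vec X\eta(\vec Y)-\vec Y\eta(\vec X)-\eta([\vec X,\vec Y])\big)$. *)

(* Defs.v *)
From HB Require Import structures.
From mathcomp Require Import all_boot all_order all_algebra.
From mathcomp Require Import all_classical all_reals all_analysis.

Set Implicit Arguments.
Unset Strict Implicit.
Unset Printing Implicit Defensive.

Import Order.TTheory GRing.Theory Num.Theory.
Import numFieldNormedType.Exports.

Local Open Scope classical_set_scope.
Local Open Scope ring_scope.

Section SmoothOn.
Variables (R : realType) (n : nat).
Implicit Types (U : set 'rV[R]_n) (f g : 'rV[R]_n -> R).

Definition partial (i : 'I_n) f : 'rV[R]_n -> R :=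
  fun x => 'D_(delta_mx 0 i) f x.

(* Intended for open U only: continuity and the partial derivatives are taken
   in the whole space at each point of U. *)
Fixpoint Ck_on (k : nat) U f : Prop :=
  (forall x, U x -> {for x, continuous f}) /\
  if k is k'.+1 then
    forall i : 'I_n, (forall x, U x -> derivable f x (delta_mx 0 i)) /\
      Ck_on k' U (partial i f)
  else True.

Definition smooth_on U f : Prop := forall k, Ck_on k U f.

Definition smooth_map_on (m : nat) U (F : 'rV[R]_n -> 'rV[R]_m) : Prop :=
  forall j : 'I_m, smooth_on U (fun x => F x 0 j).

Lemma near_open_eq U f g x : open U -> {in U, f =1 g} -> U x ->
  \near x, f x = g x.
Proof.
move=> oU fg Ux; have : nbhs x U by exact: open_nbhs_nbhs.
by apply: filterS => y Uy; apply: fg; rewrite inE.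
Qed.

Lemma Ck_on_ext k U f g : open U -> {in U, f =1 g} -> Ck_on k U f -> Ck_on k U g.
Proof.
move=> oU; elim: k f g => [|k IH] f g fg [cf df].
  split=> // x Ux; have e := near_open_eq oU fg Ux.
  rewrite /prop_for /continuous_at -(fg x) ?inE//.
  exact: cvg_trans (near_eq_cvg e) (cf x Ux).
split=> [x Ux|i].
  have e := near_open_eq oU fg Ux.
  rewrite /prop_for /continuous_at -(fg x) ?inE//.
  exact: cvg_trans (near_eq_cvg e) (cf x Ux).
have [dfi Ci] := df i; split=> [x Ux|].
  have e := near_open_eq oU fg Ux.
  have [] // := near_eq_is_derive e (derivableP (dfi x Ux)).
apply: IH Ci => x; rewrite inE => Ux.
by rewrite /partial; apply: near_eq_derive; exact: (near_open_eq oU fg Ux).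
Qed.

Lemma Ck_onW k U f : Ck_on k.+1 U f -> Ck_on k U f.
Proof.
elim: k f => [|k IH] f [cf df]; split => // i.
by have [dfi Ci] := df i; split => //; apply: IH.
Qed.

Lemma Ck_on_cst k U (c : R) : Ck_on k U (cst c).
Proof.
elim: k c => [|k IH] c; split => //; try by move=> x _; exact: cst_continuous.
move=> i; split; first by move=> x _; exact: derivable_cst.
rewrite (_ : partial _ _ = cst 0); first exact: IH.
by apply/funext => x; rewrite /partial derive_cst.
Qed.

Lemma Ck_onD k U f g : open U -> Ck_on k U f -> Ck_on k U g -> Ck_on k U (f + g).
Proof.
move=> oU; elim: k f g => [|k IH] f g [cf df] [cg dg].
  by split=> // x Ux; exact: (continuousD (cf x Ux) (cg x Ux)).
split=> [x Ux|i]; first by exact: (continuousD (cf x Ux) (cg x Ux)).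
have [dfi Cfi] := df i; have [dgi Cgi] := dg i; split.
  by move=> x Ux; apply: derivableD; [exact: dfi|exact: dgi].
apply: (Ck_on_ext oU _ (IH _ _ Cfi Cgi)) => x; rewrite inE => Ux.
by rewrite /partial deriveD//; [exact: dfi|exact: dgi].
Qed.

Lemma Ck_onM k U f g : open U -> Ck_on k U f -> Ck_on k U g -> Ck_on k U (f * g).
Proof.
move=> oU; elim: k f g => [|k IH] f g Cf Cg; have [cf df] := Cf;
  have [cg dg] := Cg.
  by split=> // x Ux; exact: (continuousM (cf x Ux) (cg x Ux)).
split=> [x Ux|i]; first by exact: (continuousM (cf x Ux) (cg x Ux)).
have [dfi Cfi] := df i; have [dgi Cgi] := dg i; split.
  by move=> x Ux; apply: derivableM; [exact: dfi|exact: dgi].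
have h1 := IH _ _ (Ck_onW Cf) Cgi; have h2 := IH _ _ (Ck_onW Cg) Cfi.
apply: (Ck_on_ext oU _ (Ck_onD oU h1 h2)) => x; rewrite inE => Ux.
by rewrite /partial deriveM//; [exact: dfi|exact: dgi].
Qed.

End SmoothOn.

Section Manifolds.
Variables (R : realType) (n : nat).

Record chart (T : topologicalType) := Chart {
  chart_dom : set T ;
  chart_cod : set 'rV[R]_n ;
  chart_fun : T -> 'rV[R]_n ;
  chart_inv : 'rV[R]_n -> T ;
  chart_dom_open : open chart_dom ;
  chart_cod_open : open chart_cod ;
  chart_funP : forall p, chart_dom p -> chart_cod (chart_fun p) ;
  chart_invP : forall x, chart_cod x -> chart_dom (chart_inv x) ;
  chart_funK : forall p, chart_dom p -> chart_inv (chart_fun p) = p ;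
  chart_invK : forall x, chart_cod x -> chart_fun (chart_inv x) = x ;
  chart_fun_cont : forall p, chart_dom p -> {for p, continuous chart_fun} ;
  chart_inv_cont : forall x, chart_cod x -> {for x, continuous chart_inv}
}.

Definition compatible_charts (T : topologicalType) (c d : chart T) : Prop :=
  smooth_map_on (chart_cod c `&` chart_inv c @^-1` chart_dom d)
    (chart_fun d \o chart_inv c).

(* The atlas need not be maximal: it has the same smooth functions as the
   maximal atlas containing it. *)
Record smoothManifold := SmoothManifold {
  manifold_sort :> topologicalType ;
  manifold_hausdorff : hausdorff_space manifold_sort ;
  manifold_second_countable : @second_countable manifold_sort ;
  atlas : set (chart manifold_sort) ;
  atlas_cover : forall p, exists2 c, atlas c & chart_dom c p ;
  atlas_compatible : forall c d, atlas c -> atlas d -> compatible_charts c d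
}.

Definition smooth (M : smoothManifold) (f : M -> R) : Prop :=
  forall c, @atlas M c -> smooth_on (chart_cod c) (f \o chart_inv c).

End Manifolds.

Section SmoothFunctions.
Variables (R : realType) (n : nat) (M : smoothManifold R n).
Implicit Types f g : M -> R.

Lemma smooth_cst (c : R) : smooth (cst c : M -> R).
Proof. by move=> d _ k; exact: Ck_on_cst. Qed.

Lemma smoothD f g : smooth f -> smooth g -> smooth (f + g).
Proof.
move=> sf sg c Ac k.
have -> : (f + g) \o chart_inv c = (f \o chart_inv c) + (g \o chart_inv c).
  by apply/funext.
exact: (Ck_onD (@chart_cod_open _ _ _ c) (sf c Ac k) (sg c Ac k)).
Qed.

Lemma smoothM f g : smooth f -> smooth g -> smooth (f * g).
Proof.
move=> sf sg c Ac k.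
have -> : (f * g) \o chart_inv c = (f \o chart_inv c) * (g \o chart_inv c).
  by apply/funext.
exact: (Ck_onM (@chart_cod_open _ _ _ c) (sf c Ac k) (sg c Ac k)).
Qed.

Lemma smoothZ (a : R) f : smooth f -> smooth (a *: f).
Proof. by move=> sf; exact: (smoothM (smooth_cst a) sf). Qed.

Lemma smoothB f g : smooth f -> smooth g -> smooth (f - g).
Proof.
move=> sf sg; rewrite -[- g]scaleN1r; apply: smoothD => //.
exact: smoothZ.
Qed.

Definition smooth_pred : {pred M -> R} := fun f => `[< smooth f >].

Lemma smooth_subring_closed : subring_closed smooth_pred.
Proof.
split; first by apply/asboolP; exact: smooth_cst.
- by move=> f g /asboolP sf /asboolP sg; apply/asboolP; exact: smoothB.
- by move=> f g /asboolP sf /asboolP sg; apply/asboolP; exact: smoothM.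
Qed.

Lemma smooth_scaler_closed : GRing.scaler_closed smooth_pred.
Proof. by move=> a f /asboolP sf; apply/asboolP; exact: smoothZ. Qed.

HB.instance Definition _ :=
  GRing.isSubringClosed.Build (M -> R) smooth_pred smooth_subring_closed.
HB.instance Definition _ :=
  GRing.isScaleClosed.Build R (M -> R) smooth_pred smooth_scaler_closed.

Record Cinf := MkCinf { Cinf_fun :> M -> R ; CinfP : Cinf_fun \in smooth_pred }.

HB.instance Definition _ := [isSub for Cinf_fun].
HB.instance Definition _ := [Choice of Cinf by <:].
HB.instance Definition _ := GRing.SubChoice_isSubComPzRing.Build (M -> R)
  smooth_pred Cinf smooth_subring_closed.
HB.instance Definition _ := [SubZmodule_isSubLmodule of Cinf by <:].

Definition mkCinf f (sf : smooth f) : Cinf := MkCinf (asboolT sf).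

End SmoothFunctions.

Section Tangent.
Variables (R : realType) (n : nat) (M : smoothManifold R n).

(* Tangent vectors at p are the derivations at p of the algebra of smooth
   functions on M. *)
Definition derivation_at (p : M) (v : Cinf M -> R^o) : Prop :=
  (forall (a : R) (f g : Cinf M), v (a *: f + g) = a * v f + v g) /\
  (forall f g : Cinf M, v (f * g) = f p * v g + g p * v f).

Definition derivation_pred (p : M) : {pred Cinf M -> R^o} :=
  fun v => `[< derivation_at p v >].

Lemma derivation_submod_closed p : submod_closed (derivation_pred p).
Proof.
split.
  by apply/asboolP; split=> [a f g|f g]; rewrite /= !mulr0 addr0.
move=> c u v /asboolP[lu du] /asboolP[lv dv]; apply/asboolP; split.
- move=> a f g; rewrite ![(c *: u + v) _]/(c * u _ + v _) lu lv !mulrDr.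
  by rewrite mulrCA addrACA.
- move=> f g; rewrite ![(c *: u + v) _]/(c * u _ + v _) du dv !mulrDr.
  by rewrite (mulrCA c) (mulrCA c (g p)) addrACA.
Qed.

HB.instance Definition _ p :=
  GRing.isSubmodClosed.Build R (Cinf M -> R^o) (derivation_pred p)
    (derivation_submod_closed p).

Record tangent (p : M) := MkTangent {
  tangent_fun :> Cinf M -> R^o ;
  tangentP : tangent_fun \in derivation_pred p }.

HB.instance Definition _ p := [isSub for @tangent_fun p].
HB.instance Definition _ p := [Choice of tangent p by <:].
HB.instance Definition _ p := [SubChoice_isSubLmodule of tangent p by <:].

Definition smooth_section (X : forall p, tangent p) : Prop :=
  forall f : Cinf M, smooth (fun p => X p f : R).

Record vfield := MkVfield {
  vfield_fun :> forall p, tangent p ;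
  vfieldP : smooth_section vfield_fun }.

Lemma vfield_ext (X Y : vfield) : (forall p, X p = Y p) -> X = Y.
Proof.
case: X Y => [X sX] [Y sY] /= XY; have e : X = Y by apply: functional_extensionality_dep.
by subst Y; congr MkVfield; exact: Prop_irrelevance.
Qed.

HB.instance Definition _ := gen_eqMixin vfield.
HB.instance Definition _ := gen_choiceMixin vfield.

Lemma Cinf_smooth (f : Cinf M) : smooth f.
Proof. by case: f => f /= /asboolP. Qed.

Program Definition vfield0 : vfield := @MkVfield (fun=> 0) _.
Next Obligation. by move=> f; exact: (@smooth_cst _ _ M 0). Qed.

Program Definition vfieldN (X : vfield) : vfield :=
  @MkVfield (fun p => - X p) _.
Next Obligation.
move=> X f; have := smoothZ (-1) (vfieldP X f); congr smooth.
by apply/funext => p; rewrite [LHS]mulN1r.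
Qed.

Program Definition vfieldD (X Y : vfield) : vfield :=
  @MkVfield (fun p => X p + Y p) _.
Next Obligation. by move=> X Y f; exact: (smoothD (vfieldP X f) (vfieldP Y f)). Qed.

Program Definition vfieldZ (h : Cinf M) (X : vfield) : vfield :=
  @MkVfield (fun p => h p *: X p) _.
Next Obligation.
by move=> h X f; exact: (smoothM (Cinf_smooth h) (vfieldP X f)).
Qed.

Lemma vfieldDA : associative vfieldD.
Proof. by move=> X Y Z; apply: vfield_ext => p; exact: addrA. Qed.

Lemma vfieldDC : commutative vfieldD.
Proof. by move=> X Y; apply: vfield_ext => p; exact: addrC. Qed.

Lemma vfield0D : left_id vfield0 vfieldD.
Proof. by move=> X; apply: vfield_ext => p; exact: add0r. Qed.

Lemma vfieldND : left_inverse vfield0 vfieldN vfieldD.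
Proof. by move=> X; apply: vfield_ext => p; exact: addNr. Qed.

HB.instance Definition _ :=
  GRing.isZmodule.Build vfield vfieldDA vfieldDC vfield0D vfieldND.

Lemma vfieldZA (a b : Cinf M) (X : vfield) :
  vfieldZ a (vfieldZ b X) = vfieldZ (a * b) X.
Proof. by apply: vfield_ext => p; exact: scalerA. Qed.

Lemma vfield1Z : left_id 1 vfieldZ.
Proof. by move=> X; apply: vfield_ext => p; exact: scale1r. Qed.

Lemma vfieldZDr : right_distributive vfieldZ +%R.
Proof. by move=> a X Y; apply: vfield_ext => p; exact: scalerDr. Qed.

Lemma vfieldZDl (X : vfield) : {morph vfieldZ^~ X : a b / a + b}.
Proof. by move=> a b; apply: vfield_ext => p; exact: scalerDl. Qed.

HB.instance Definition _ := GRing.Zmodule_isLmodule.Build (Cinf M) vfield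
  vfieldZA vfield1Z vfieldZDr vfieldZDl.

Definition vapp (X : vfield) (f : Cinf M) : Cinf M := mkCinf (vfieldP X f).

Definition bracket_fun (X Y : vfield) (p : M) (f : Cinf M) : R^o :=
  X p (vapp Y f) - Y p (vapp X f).

Lemma bracket_derivation X Y p : bracket_fun X Y p \in derivation_pred p.
Proof.
have tP (q : M) (v : tangent q) : derivation_at q v by case: v => v /= /asboolP.
apply/asboolP; split.
- move=> a f g; rewrite /bracket_fun.
  have E (Z : vfield) : vapp Z (a *: f + g) = a *: vapp Z f + vapp Z g.
    by apply/val_inj/funext => q; exact: (tP q (Z q)).1.
  by rewrite !E !(tP p (_ p)).1 mulrBr opprD addrACA.
- move=> f g; rewrite /bracket_fun.
  have E (Z : vfield) : vapp Z (f * g) = f * vapp Z g + g * vapp Z f.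
    by apply/val_inj/funext => q; exact: (tP q (Z q)).2.
  have D (v : tangent p) (h k : Cinf M) : v (h + k) = v h + v k.
    by rewrite -[h in LHS]scale1r (tP p v).1 mul1r.
  rewrite !E !D !(tP p (_ p)).2 !mulrBr.
  rewrite [X in X - _](_ : _ = (f p * X p (vapp Y g) + g p * X p (vapp Y f)) +
    (Y p g * X p f + Y p f * X p g)); last by rewrite addrACA.
  rewrite [X in _ - X](_ : _ = (f p * Y p (vapp X g) + g p * Y p (vapp X f)) +
    (Y p g * X p f + Y p f * X p g)); last first.
    rewrite addrACA; congr (_ + _).
    by rewrite addrC mulrC [X in _ + X]mulrC.
  by rewrite opprD addrACA subrr addr0 opprD addrACA.
Qed.

Program Definition bracket (X Y : vfield) : vfield :=
  @MkVfield (fun p => MkTangent (bracket_derivation X Y p)) _.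
Next Obligation.
move=> X Y f.
exact: (smoothB (vfieldP X (vapp Y f)) (vfieldP Y (vapp X f))).
Qed.

End Tangent.

Section Tensors.
Variables (R : realType) (n : nat) (M : smoothManifold R n).

Record tensor11 := MkTensor11 {
  tensor11_fun :> forall p : M, {linear tangent p -> tangent p} ;
  tensor11P : forall X : vfield M, smooth_section (fun p => tensor11_fun p (X p)) }.

Record oneform := MkOneform {
  oneform_fun :> forall p : M, {linear tangent p -> R^o} ;
  oneformP : forall X : vfield M, smooth (fun p => oneform_fun p (X p) : R) }.

(* Pseudo-Riemannian metric: no constraint on the signature. *)
Record metric := MkMetric {
  metric_fun :> forall p : M, tangent p -> tangent p -> R ;
  metric_linear : forall p (v : tangent p) a (u w : tangent p),
    metric_fun (a *: u + w) v = a * metric_fun u v + metric_fun w v ;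
  metric_sym : forall p (u v : tangent p), metric_fun u v = metric_fun v u ;
  metric_nondegenerate : forall p (u : tangent p),
    (forall v, metric_fun u v = 0) -> u = 0 ;
  metricP : forall X Y : vfield M, smooth (fun p => metric_fun (X p) (Y p)) }.

Definition tensor11_app (phi : tensor11) (X : vfield M) : vfield M :=
  MkVfield (tensor11P phi X).

Definition oneform_app (eta : oneform) (X : vfield M) : Cinf M :=
  mkCinf (oneformP eta X).

Definition metric_app (g : metric) (X Y : vfield M) : Cinf M :=
  mkCinf (metricP g X Y).

Record almost_contact_metric (phi : tensor11) (xi : vfield M) (eta : oneform)
    (g : metric) : Prop := AlmostContactMetric {
  acm_eta_xi : oneform_app eta xi = 1 ;
  acm_phi_xi : tensor11_app phi xi = 0 ;
  acm_eta_phi : forall X, oneform_app eta (tensor11_app phi X) = 0 ;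
  acm_phi_phi : forall X, tensor11_app phi (tensor11_app phi X) =
    - X + oneform_app eta X *: xi ;
  acm_metric : forall X Y,
    metric_app g (tensor11_app phi X) (tensor11_app phi Y) =
    metric_app g X Y - oneform_app eta X * oneform_app eta Y }.

Definition nijenhuis (phi : tensor11) (X Y : vfield M) : vfield M :=
  let phi := tensor11_app phi in
  bracket (phi X) (phi Y) + phi (phi (bracket X Y))
  - phi (bracket (phi X) Y) - phi (bracket X (phi Y)).

Definition extd (eta : oneform) (X Y : vfield M) : Cinf M :=
  2^-1 *: (vapp X (oneform_app eta Y) - vapp Y (oneform_app eta X)
           - oneform_app eta (bracket X Y)).

Definition normal (phi : tensor11) (xi : vfield M) (eta : oneform) : Prop :=
  forall X Y, nijenhuis phi X Y + (2 * extd eta X Y) *: xi = 0.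

Definition kerform (eta : oneform) (p : M) : set (tangent p) :=
  [set u | eta p u = 0].

Definition section_ker (eta : oneform) (X : vfield M) : Prop :=
  forall p, kerform eta (X p).

(* In the next two definitions omega is a 2-form, given by its action on vector
   fields, and a tangent vector at p is given as the value X p of a global
   vector field: every tangent vector is of this form, and omega X Y p depends
   only on X p and Y p. *)
Definition nondegenerate_on_ker (omega : vfield M -> vfield M -> Cinf M)
    (eta : oneform) : Prop :=
  forall (p : M) (X : vfield M), kerform eta (X p) ->
    (forall Y : vfield M, kerform eta (Y p) -> omega X Y p = 0) ->
    X p = 0.

Definition kernel_eq_span (omega : vfield M -> vfield M -> Cinf M)
    (xi : vfield M) : Prop :=
  forall (p : M) (X : vfield M),
    (forall Y : vfield M, omega X Y p = 0) <->
    (exists c : R, X p = c *: xi p).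

Definition projection_along (P : tensor11) (xi : vfield M) (eta : oneform) :
    Prop :=
  forall (p : M) (u : tangent p),
    kerform eta (P p u) /\ exists c : R, u - P p u = c *: xi p.

End Tensors.

(* Main.v *)
Require Import Defs.
From mathcomp Require Import all_boot all_order all_algebra.
From mathcomp Require Import all_classical all_reals all_analysis.

Import GRing.Theory.
Local Open Scope ring_scope.

(** Everything is controlled by the [xi]-component of the torsion. Since
    [eta] vanishes on the image of [phi], the last three terms of
    [N(U, V) = [phi U, phi V] + phi^2 [U, V] - phi [phi U, V] - phi [U, phi V]]
    are killed by [eta], and the two derivative terms of
    [2 d eta (phi U, phi V)] vanish, so that
    [eta (N(U, V)) = eta [phi U, phi V] = - 2 d eta (phi U, phi V)]
    ([oneform_nijenhuis]).

    Normality says that [N(U, V)] is the multiple of [xi] with coefficient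
    [- 2 d eta (U, V)]. Being a multiple of [xi] is the condition [P N = 0],
    because [P] has kernel spanned by [xi] ([projection_xi],
    [ker_projection]); and, given that, comparing the coefficients through
    [eta] turns normality into [d eta (phi U, phi V) = d eta (U, V)] for all
    vector fields. It remains to pass from sections of [ker eta] to all vector
    fields: [U] and its horizontal part [U - eta(U) xi] have the same image
    under [phi], and the same products under [d eta] because [xi] spans the
    kernel of [d eta] ([extd_hpart]). *)

Section VectorFields.
Context {R : realType} {n : nat} {M : smoothManifold R n}.
Implicit Types (X Y : vfield M) (f g : Cinf M) (phi : tensor11 M)
  (eta : oneform M).

Lemma Cinf_ext f g : (forall p, f p = g p) -> f = g.
Proof. by move=> fg; apply/val_inj/funext. Qed.

Lemma tangentD (p : M) (v : tangent p) f g : v (f + g) = v f + v g.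
Proof.
case: v => v /= /asboolP[lin _].
by rewrite -[f in LHS]scale1r lin mul1r.
Qed.

Lemma vappDr X f g : vapp X (f + g) = vapp X f + vapp X g.
Proof. by apply: Cinf_ext => p; exact: tangentD. Qed.

Lemma vapp0r X : vapp X 0 = 0.
Proof. by apply: (addrI (vapp X 0)); rewrite -vappDr !addr0. Qed.

Lemma vappDl X Y f : vapp (X + Y) f = vapp X f + vapp Y f.
Proof. exact: Cinf_ext. Qed.

Lemma vapp_bracket X Y f :
  vapp (bracket X Y) f = vapp X (vapp Y f) - vapp Y (vapp X f).
Proof. exact: Cinf_ext. Qed.

Lemma vfield_vapp_ext X Y : (forall f, vapp X f = vapp Y f) -> X = Y.
Proof.
move=> XY; apply: vfield_ext => p; apply/val_inj/funext => f.
exact: (congr1 (fun h : Cinf M => h p) (XY f)).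
Qed.

Lemma bracketDl X X' Y : bracket (X + X') Y = bracket X Y + bracket X' Y.
Proof.
apply: vfield_vapp_ext => f.
by rewrite vappDl !vapp_bracket !vappDl vappDr opprD addrACA.
Qed.

Lemma bracketC X Y : bracket X Y = - bracket Y X.
Proof.
apply/eqP; rewrite -addr_eq0; apply/eqP.
apply: vfield_vapp_ext => f.
rewrite vappDl !vapp_bracket addrA subrK subrr.
exact: Cinf_ext.
Qed.

Lemma oneform_appD eta X Y :
  oneform_app eta (X + Y) = oneform_app eta X + oneform_app eta Y.
Proof. by apply: Cinf_ext => p; exact: raddfD. Qed.

Lemma oneform_appN eta X : oneform_app eta (- X) = - oneform_app eta X.
Proof. by apply: Cinf_ext => p; exact: raddfN. Qed.

Lemma oneform_appZ eta f X :
  oneform_app eta (f *: X) = f * oneform_app eta X.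
Proof. by apply: Cinf_ext => p; exact: linearZ. Qed.

Lemma tensor11_appD phi X Y :
  tensor11_app phi (X + Y) = tensor11_app phi X + tensor11_app phi Y.
Proof. by apply: vfield_ext => p; exact: raddfD. Qed.

Lemma tensor11_appZ phi f X :
  tensor11_app phi (f *: X) = f *: tensor11_app phi X.
Proof. by apply: vfield_ext => p; exact: linearZ. Qed.

Lemma half_double f : 2^-1 *: (2 * f) = f.
Proof.
by rewrite mulr_natl -[f *+ 2](@scaler_nat R) scalerA mulVf ?scale1r //.
Qed.

Lemma double_half f : 2 * (2^-1 *: f) = f.
Proof.
by rewrite mulr_natl -[(_ *: f) *+ 2](@scaler_nat R) scalerA mulfV ?scale1r //.
Qed.

Lemma double_inj : injective (fun f : Cinf M => 2 * f).
Proof. exact: can_inj half_double. Qed.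

Lemma double_extd eta X Y :
  2 * extd eta X Y = vapp X (oneform_app eta Y) - vapp Y (oneform_app eta X)
    - oneform_app eta (bracket X Y).
Proof. exact: double_half. Qed.

Lemma extdC eta X Y : extd eta X Y = - extd eta Y X.
Proof.
rewrite /extd -scalerN (bracketC X Y) oneform_appN !opprD !opprK.
by rewrite [in RHS](addrC (- _)).
Qed.

Lemma extdDl eta X X' Y : extd eta (X + X') Y = extd eta X Y + extd eta X' Y.
Proof.
rewrite /extd -scalerDr; congr (_ *: _).
rewrite vappDl bracketDl !oneform_appD vappDr !opprD.
by rewrite (addrACA (vapp X _)) [RHS]addrACA.
Qed.

Lemma extdDr eta X Y Y' : extd eta X (Y + Y') = extd eta X Y + extd eta X Y'.
Proof. by rewrite extdC extdDl opprD -!(extdC _ X). Qed.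

(** The [xi]-component of the torsion only sees the first of its four terms:
    [eta] kills the image of [phi]. *)
Lemma oneform_nijenhuis phi eta :
  (forall X, oneform_app eta (tensor11_app phi X) = 0) ->
  forall X Y, oneform_app eta (nijenhuis phi X Y) =
    - (2 * extd eta (tensor11_app phi X) (tensor11_app phi Y)).
Proof.
move=> eta_phi X Y; rewrite double_extd !eta_phi !vapp0r subrr sub0r opprK.
by rewrite /nijenhuis !(oneform_appD, oneform_appN) !eta_phi oppr0 !addr0.
Qed.

End VectorFields.

Section Splitting.
Context {R : realType} {n : nat} {M : smoothManifold R n}.
Variables (xi : vfield M) (eta : oneform M).
Hypothesis eta_xi : oneform_app eta xi = 1.
Implicit Types (X Y : vfield M) (phi P : tensor11 M).

Lemma eta_xi_at p : eta p (xi p) = 1.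
Proof. exact: (congr1 (fun f : Cinf M => f p) eta_xi). Qed.

Definition hpart X : vfield M := X - oneform_app eta X *: xi.

Lemma hpartK X : hpart X + oneform_app eta X *: xi = X.
Proof. exact: subrK. Qed.

Lemma section_ker_hpart X : section_ker eta (hpart X).
Proof.
move=> p; apply: (congr1 (fun f : Cinf M => f p) (_ : oneform_app eta _ = 0)).
by rewrite oneform_appD oneform_appN oneform_appZ eta_xi mulr1 subrr.
Qed.

Lemma tensor11_hpart phi X : tensor11_app phi xi = 0 ->
  tensor11_app phi (hpart X) = tensor11_app phi X.
Proof.
move=> phi_xi; rewrite -[in RHS](hpartK X) tensor11_appD tensor11_appZ phi_xi.
by rewrite scaler0 addr0.
Qed.

(** The kernel hypothesis is pointwise, so [d eta] annihilates [f *: xi] for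
    every smooth function [f], and additivity suffices to discard the vertical
    parts. *)
Lemma extd_hpart X Y : kernel_eq_span (extd eta) xi ->
  extd eta (hpart X) (hpart Y) = extd eta X Y.
Proof.
move=> ker; have ker0 f Z : extd eta (f *: xi) Z = 0.
  by apply: Cinf_ext => p; apply: (ker p (f *: xi)).2; exists (f p).
rewrite -[in RHS](hpartK X) -[in RHS](hpartK Y) extdDl ker0 addr0.
by rewrite extdDr (extdC _ _ (_ *: xi)) ker0 oppr0 addr0.
Qed.

Lemma projection_xi P : projection_along P xi eta -> tensor11_app P xi = 0.
Proof.
move=> projP; apply: vfield_ext => p /=.
have [etaP [c xiP]] := projP p (xi p).
(* Applying [eta] to [xi - P xi = c xi] forces [c = 1]. *)
have c1 : c = 1.
  have := congr1 (eta p) xiP.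
  by rewrite raddfB linearZ /= etaP eta_xi_at subr0 /GRing.scale /= mulr1.
by apply: (subrI (xi p)); rewrite xiP c1 scale1r subr0.
Qed.

(** [X - P X] is always a multiple of [xi]; when [P X] vanishes this is [X]
    itself, and [eta] reads off the coefficient. *)
Lemma ker_projection P X : projection_along P xi eta ->
  tensor11_app P X = 0 -> X = oneform_app eta X *: xi.
Proof.
move=> projP PX0; apply: vfield_ext => p.
have Pp : P p (X p) = 0 by exact: (congr1 (fun Z : vfield M => Z p) PX0).
have [_ [c]] := projP p (X p); rewrite Pp subr0 => Xc.
rewrite [RHS](_ : _ = eta p (X p) *: xi p) // Xc linearZ /= eta_xi_at.
by rewrite [c *: 1]mulr1.
Qed.

End Splitting.

Theorem theorem3 (R : realType) (n : nat) (odd_n : odd n)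
  (X : smoothManifold R n)
  (phi : tensor11 X) (xi : vfield X) (eta : oneform X) (g : metric X)
  (acm : almost_contact_metric phi xi eta g)
  (nondeg : nondegenerate_on_ker (extd eta) eta)
  (kernel : kernel_eq_span (extd eta) xi)
  (P : tensor11 X) (projP : projection_along P xi eta) :
  normal phi xi eta <->
  ((forall U V : vfield X, tensor11_app P (nijenhuis phi U V) = 0) /\
   (forall u v : vfield X, section_ker eta u -> section_ker eta v ->
      extd eta (tensor11_app phi u) (tensor11_app phi v) = extd eta u v)).
Proof.
have eta_xi := acm_eta_xi acm; have phi_xi := acm_phi_xi acm.
have etaN := oneform_nijenhuis _ _ (acm_eta_phi acm).
split=> [norm | [PN0 inv] U V].
  have NE U V : nijenhuis phi U V = - (2 * extd eta U V) *: xi.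
    by apply/eqP; rewrite scaleNr -addr_eq0; apply/eqP; exact: norm.
  split=> [U V | u v _ _].
    by rewrite NE tensor11_appZ (projection_xi _ _ eta_xi _ projP) scaler0.
  have := etaN u v; rewrite NE oneform_appZ eta_xi mulr1 => /oppr_inj/esym.
  exact: double_inj.
rewrite (ker_projection _ _ eta_xi _ _ projP (PN0 U V)) etaN.
rewrite -(tensor11_hpart _ eta _ U phi_xi) -(tensor11_hpart _ eta _ V phi_xi).
rewrite inv; [|exact: section_ker_hpart..].
by rewrite extd_hpart // -scalerDl addNr scale0r.
Qed.
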